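(* Let $\Delta>0$ and $p>0$. Suppose the times at which a web page changes form a time-homogeneous Poisson point process on $[0,\infty)$ with rate $\Delta$, and, independently, the page is accessed at times $0=t_0<t_1<t_2<\cdots$ where $\{t_k-t_{k-1}\}_{k\ge1}$ are i.i.d. exponential random variables with rate $p$. For $k\ge 1$ let $I_k=1$ if the page changed at least once in $(t_{k-1},t_k]$ and $I_k=0$ otherwise. Let $\{\eta_k\}_{k\ge0}$ be a sequence of positive reals, let $y_0\in\mathbb{R}$, and define \[ y_{k+1}=y_k+\eta_k\big[I_{k+1}(y_k+p)-y_k\big],\qquad k\ge 0. \] Then: 1. If $\sum_{k=0}^\infty\eta_k=\infty$ and $\sum_{k=0}^\infty\eta_k^2<\infty$, then $\lim_{k\to\infty}y_k=\Delta$ almost surely. 2. If $\eta_k=1/(k+1)^{\eta}$ for some constant $\eta\in(0,1)$, then $\mathbb{E}|y_k-\Delta|=O\left(k^{-\eta/2}\right)$.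
   Context: Here $\Delta$ is unknown (to be estimated) and $p$ is known; $y_k$ is called the SA estimator. *)

(* Defs.v *)
From HB Require Import structures.
From mathcomp Require Import all_boot all_order all_algebra.
From mathcomp Require Import all_classical all_reals all_analysis.
Set Implicit Arguments. Unset Strict Implicit. Unset Printing Implicit Defensive.
Import Order.TTheory GRing.Theory Num.Theory.
Import numFieldNormedType.Exports.
Local Open Scope classical_set_scope.
Local Open Scope ring_scope.

(* Mutual independence of the whole family {X i, Y i : i in nat} of real
   random variables: for every n and Borel sets A_i, B_i (i < n), the
   probability of the joint event is the product of the marginals.
   (Taking A_i or B_i = setT yields every finite subfamily.) *)
Definition mutually_independent2 d (T : measurableType d) (R : realType)
    (P : probability T R) (X Y : nat -> T -> R) : Prop :=
  forall (n : nat) (A B : nat -> set R),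
    (forall i, (i < n)%N -> measurable (A i)) ->
    (forall i, (i < n)%N -> measurable (B i)) ->
    P (\bigcap_(i in `I_n) (X i @^-1` A i `&` Y i @^-1` B i)) =
    (\prod_(i < n) (P (X i @^-1` A i) * P (Y i @^-1` B i)))%E.

Definition exponentially_distributed d (T : measurableType d) (R : realType)
    (P : probability T R) (rate : R) (X : T -> R) : Prop :=
  forall A : set R, measurable A -> P (X @^-1` A) = exponential_prob rate A.

Definition access_time T (R : realType) (tau : nat -> T -> R) (k : nat) (w : T) : R :=
  \sum_(i < k) tau i w.

(* change times of the Poisson process: C_j = sigma_0 + ... + sigma_j,
   sigma_j i.i.d. exponential(Delta) inter-event times *)
Definition change_time T (R : realType) (sigma : nat -> T -> R) (j : nat) (w : T) : R :=
  \sum_(i < j.+1) sigma i w.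

Definition change_ind T (R : realType) (sigma tau : nat -> T -> R) (k : nat) (w : T) : R :=
  (`[< exists j, access_time tau k w < change_time sigma j w /\
                 change_time sigma j w <= access_time tau k.+1 w >])%:R.

Fixpoint sa_estimator T (R : realType) (sigma tau : nat -> T -> R)
    (eta : nat -> R) (p y0 : R) (k : nat) (w : T) : R :=
  match k with
  | 0 => y0
  | k'.+1 =>
      let y := sa_estimator sigma tau eta p y0 k' w in
      y + eta k' * (change_ind sigma tau k' w * (y + p) - y)
  end.

(* Main.v *)
(* Superposing the two renewal processes with exponential gaps gives a race:
   by lack of memory, whatever has happened so far, the next event is a change
   with probability q = Delta / (Delta + p) and an access otherwise, and the
   residual clocks are again independent exponentials. Hence the indicators I_k
   are i.i.d. Bernoulli(q). The event [I_0 .. I_{n-1} = b] is only bounded from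
   below, by restricting to finitely many changes and no ties; since the lower bounds sum to
   1 over all b, they are equalities.

   With z_k = y_k - Delta, the conditional mean of y_{k+1} - y_k is
   - (1 - q) eta_k z_k, so E z_k^2 satisfies a recursion whose solution is
   O(eta_k) for eta_k = (k+1)^-e, and E |z_k| = O(k^(-e/2)) follows by AM-GM.

   For almost sure convergence, S_n = sum_{k<n} eta_k (I_k - q) converges a.s. by
   a Kolmogorov-type maximal inequality; the rest is pathwise: the recursion is
   z_{k+1} = (1 - a_k) z_k + (Delta + p) (S_{k+1} - S_k) with
   a_k = eta_k (1 - I_k), and subtracting (Delta + p) (S_k - lim S) from z_k turns
   it into a contraction with vanishing perturbation, where sum_k a_k = oo. *)

Require Import Defs.
From HB Require Import structures.
From mathcomp Require Import all_boot all_order all_algebra.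
From mathcomp Require Import all_classical all_reals all_analysis.
From mathcomp Require Import measurable_realfun ring lra.
Set Implicit Arguments. Unset Strict Implicit. Unset Printing Implicit Defensive.
Import Order.TTheory GRing.Theory Num.Theory.
Import numFieldNormedType.Exports.
Local Open Scope classical_set_scope.
Local Open Scope ring_scope.

(** * Competing exponential clocks *)

Section exponential_race.
Context {R : realType}.
Local Notation mu := (@lebesgue_measure R).

Lemma lebesgue_measure_translation (x : R) (A : set R) : measurable A ->
  pushforward mu (fun v : measurableTypeR R => v - x : measurableTypeR R) A = mu A.
Proof.
have mS : measurable_fun [set: measurableTypeR R]
    (fun v : measurableTypeR R => v - x : measurableTypeR R).
  exact: measurable_funB.
move=> mA; apply/esym/(@lebesgue_measure_unique R
  (measure_function_pushforward__canonical__measure_function_Measure mu mS)) => //.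
move=> _ [[a b]] _ <-.
rewrite /= /pushforward.
rewrite [X in _ = mu X](_ : _ = `]a + x, b + x]%classic); last first.
  by apply/seteqP; split=> v /=; rewrite !in_itv/= ltrBrDr lerBlDr.
rewrite !lebesgue_measure_itv/= !lte_fin ltrD2r.
by case: ifPn => // _; rewrite -!EFinB opprD addrACA subrr addr0.
Qed.

Context (r : R) (r_gt0 : 0 < r).

Definition expP : probability (measurableTypeR R) R :=
  exponential_distribution_exponential_prob__canonical__probability_measure_Probability
    r_gt0.

Lemma measurable_exponential_pdfE (D : set R) :
  measurable_fun D (EFin \o exponential_pdf r).
Proof.
by apply/measurable_funTS/measurableT_comp => //; exact: measurable_exponential_pdf.
Qed.

Lemma exponential_pdfE_ge0 (x : R) : (0 <= (exponential_pdf r x)%:E)%E.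
Proof. by rewrite lee_fin exponential_pdf_ge0// ltW. Qed.

Lemma exponential_prob_le0 : expP [set` `]-oo, 0%R]] = 0%E.
Proof.
rewrite /= /exponential_prob -integral_itv_bndo_bndc; last first.
  exact: measurable_exponential_pdfE.
rewrite integral0_eq// => x /=; rewrite in_itv/= => x0.
by rewrite lt0_exponential_pdf.
Qed.

Lemma exponential_prob_gt0 (B : set R) : measurable B ->
  expP (B `&` `]0, +oo[) = expP B.
Proof.
move=> mB; rewrite [RHS](measureDI expP mB
  (measurable_itv `]0%R, +oo[)).
rewrite [X in (X + _)%E](_ : _ = 0%E) ?add0e//.
apply/eqP; rewrite -measure_le0 /= -exponential_prob_le0.
apply: (@le_measure _ _ _ expP); rewrite ?inE//.
  exact: measurableD.
by move=> x [_] /=; rewrite !in_itv/= andbT => /negP; rewrite -leNgt.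
Qed.

(** For [v = x + y] with [y > 0] the density at [v] is [expR (- r * x)] times the density at [y],
    and Lebesgue measure is translation invariant. [B] is first cut down to []0, +oo[], since this
    factorisation fails where the density is zero. *)
Lemma exponential_memoryless (x : R) (B : set R) : 0 <= x -> measurable B ->
  expP [set v | x < v /\ B (v - x)] =
  ((expR (- r * x))%:E * expP B)%E.
Proof.
move=> x0 mB.
have mS : measurable_fun setT (fun v : measurableTypeR R => v - x : measurableTypeR R).
  exact: measurable_funB.
have mB0 : measurable (B `&` `]0, +oo[) by exact: measurableI.
have -> : [set v | x < v /\ B (v - x)] =
    (fun v => v - x) @^-1` (B `&` `]0, +oo[).
  by apply/seteqP; split => v /=; rewrite in_itv/= andbT subr_gt0 => -[].
rewrite -(exponential_prob_gt0 mB) /= /exponential_prob.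
transitivity (\int[mu]_(v in (fun v => v - x)%R @^-1` (B `&` `]0%R, +oo[))
   (((fun y => (expR (- r * x))%:E * (exponential_pdf r y)%:E)
       \o (fun v => v - x)%R) v))%E.
  apply: eq_integral => v /set_mem /=[_]; rewrite in_itv/= andbT subr_gt0 => xv.
  rewrite /= !exponential_pdfE ?subr_ge0 ?(ltW xv) ?(le_trans x0 (ltW xv))//.
  by rewrite -EFinM mulrCA -expRD; congr (_ * expR _)%:E; ring.
rewrite -(@ge0_integral_pushforward _ _ (measurableTypeR R) (measurableTypeR R)
  R _ mS mu)//; last 2 first.
- by apply: emeasurable_funM => //; exact: measurable_exponential_pdfE.
- by move=> y _; rewrite mule_ge0 ?exponential_pdfE_ge0// lee_fin expR_ge0.
transitivity (\int[mu]_(y in B `&` `]0%R, +oo[)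
   ((expR (- r * x))%:E * (exponential_pdf r y)%:E))%E.
  by apply: eq_measure_integral => A mA _; exact: lebesgue_measure_translation.
rewrite ge0_integralZl//.
- exact: measurable_exponential_pdfE.
- by move=> y _; exact: exponential_pdfE_ge0.
Qed.

Lemma exponential_prob_dominates : expP `<< mu.
Proof.
apply/null_content_dominatesP => A mA muA0 /=.
by rewrite /= /exponential_prob (null_set_integral mA)//; exact: measurable_exponential_pdfE.
Qed.

(** The density agrees almost everywhere with the Radon-Nikodym derivative of [expP], both having
    the same integral over every measurable set. *)
Lemma integral_exponential_prob (f : R -> \bar R) (U : set R) : measurable U ->
  expP.-integrable U f ->
  (\int[expP]_(x in U) f x =
   \int[mu]_(x in U) (f x * (exponential_pdf r x)%:E))%E.
Proof.
move=> mU intf.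
have mf := measurable_int _ intf.
rewrite -(Radon_Nikodym_change_of_variables exponential_prob_dominates mU intf).
apply: ae_eq_integral => //.
- apply: emeasurable_funM => //; apply: (measurable_int mu).
  apply: (integrableS _ _ (@subsetT _ _)) => //=.
  by apply: Radon_Nikodym_integrable; exact: exponential_prob_dominates.
- by apply: emeasurable_funM => //=; exact: measurable_exponential_pdfE.
- apply: ae_eqe_mul2l => /=.
  rewrite Radon_NikodymE//=; first exact: exponential_prob_dominates.
  move=> dom; case: cid => /= h [h1 h2 h3].
  apply: integral_ae_eq => //=.
  + exact: integrableS h2.
  + exact: measurable_exponential_pdfE.
  + by move=> E E01 mE; rewrite -h3.
Qed.

(** The integrand times the density of rate [r] is [r / (r + s)] times the density of rate [r + s],
    whose total mass is 1. *)
Lemma exponential_prob_laplace (s : R) : 0 < s ->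
  (\int[expP]_(x in `[0%R, +oo[) (expR (- s * x))%:E =
   (r / (r + s))%:E)%E.
Proof.
move=> s0.
have mexp D : measurable_fun D (fun x : R => (expR (- s * x))%:E).
  apply/measurable_EFinP/measurable_funTS.
  by apply: measurableT_comp => //; exact: measurable_funM.
rewrite integral_exponential_prob//; last first.
  apply: (@le_integrable _ _ _ _ _ _ _ (EFin \o cst 1)) => //; last 1 first.
  - exact: finite_measure_integrable_cst.
  - exact: mexp.
  move=> x /=; rewrite in_itv/= andbT => x0.
  rewrite /= normr1 ger0_norm ?expR_ge0// lee_fin -expR0 ler_expR.
  by rewrite mulNr oppr_le0 mulr_ge0// ltW.
have rs0 : 0 < r + s by rewrite addr_gt0.
transitivity (\int[mu]_(x in `[0%R, +oo[)
    ((r / (r + s))%R%:E * (exponential_pdf (r + s)%R x)%:E))%E.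
  apply: eq_integral => x /set_mem /=; rewrite in_itv/= andbT => x0.
  rewrite !exponential_pdfE// -!EFinM; congr EFin.
  rewrite [RHS]mulrA divfK ?gt_eqF// mulrCA -expRD; congr (_ * expR _); ring.
have mpdf : measurable_fun setT (EFin \o exponential_pdf (r + s)).
  by apply: measurableT_comp => //; exact: measurable_exponential_pdf.
have pdf0 x : (0 <= (exponential_pdf (r + s) x)%:E)%E.
  by rewrite lee_fin exponential_pdf_ge0// ltW.
rewrite ge0_integralZl//=.
- rewrite (_ : integral _ _ _ = 1%E) ?mule1//.
  rewrite -(integral_exponential_pdf rs0) integral_mkcond.
  apply: eq_integral => x _; rewrite patchE; case: ifPn => // xN.
  rewrite lt0_exponential_pdf// ltNge; apply/negP => x0.
  by move/negP : xN; apply; rewrite inE/= in_itv/= x0.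
- exact: measurable_funTS.
- by rewrite lee_fin divr_ge0// ltW.
Qed.
End exponential_race.

(** [B] full gives the probability that the first clock rings first; a general [B] adds that, given
    this, the residual time of the second clock still has law [E2]. *)
Definition races (R : realType) (E1 E2 : probability (measurableTypeR R) R) (q : R) :=
  forall B : set (measurableTypeR R), measurable B ->
    (E1 \x E2)%E [set z | z.1 < z.2 /\ B (z.2 - z.1)] = (q%:E * E2 B)%E.

Lemma measurable_race (R : realType) (B : set (measurableTypeR R)) : measurable B ->
  measurable [set z : measurableTypeR R * measurableTypeR R |
    z.1 < z.2 /\ B (z.2 - z.1)].
Proof.
move=> mB.
have m1 : measurable_fun setT (fst : measurableTypeR R * measurableTypeR R -> measurableTypeR R).
  exact: measurable_fst.
have m2 : measurable_fun setT (snd : measurableTypeR R * measurableTypeR R -> measurableTypeR R).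
  exact: measurable_snd.
have mD : measurable_fun setT
    (fun z : measurableTypeR R * measurableTypeR R => z.2 - z.1 : measurableTypeR R).
  exact: measurable_funB.
rewrite (_ : mkset _ = (fun z => z.2 - z.1) @^-1` (B `&` `]0, +oo[)).
  by rewrite -[X in measurable X]setTI; apply: mD => //; exact: measurableI.
by apply/seteqP; split => z /=; rewrite in_itv/= andbT subr_gt0 => -[].
Qed.

(** For a fixed value [x] of the first clock, lack of memory gives [expR (- s * x)] times the mass
    of [B]; integrating over [x] leaves a Laplace transform at [s]. *)
Lemma exponential_races (R : realType) (r s : R) (r0 : 0 < r) (s0 : 0 < s) :
  races (expP r0) (expP s0) (r / (r + s)).
Proof.
move=> B mB; rewrite /product_measure1.
have mZ := measurable_race mB.
have mexp D : measurable_fun D (fun x : R => (expR (- s * x))%:E).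
  apply/measurable_EFinP/measurable_funTS.
  by apply: measurableT_comp => //; exact: measurable_funM.
(* The negative half-line is null and is dropped, so that memorylessness is applied only at
   [x >= 0]. *)
rewrite (@ge0_negligible_integral _ _ _ _ _
  ([set` `]-oo, 0%R[] : set (measurableTypeR R)))//; last 2 first.
- exact: measurable_fun_xsection.
- apply/eqP; rewrite -measure_le0 -(exponential_prob_le0 r0).
  by apply: le_measure; rewrite ?inE// => x; rewrite /= !in_itv/=; exact: ltW.
have -> : [set: measurableTypeR R] `\` [set` `]-oo, 0%R[] = `[0%R, +oo[%classic.
  apply/seteqP; split => x /=; rewrite !in_itv/= ?andbT ltNge; first by case=> _ /negP/negPn.
  by move=> x0; split=> //; exact/negP/negPn.
transitivity (\int[expP r0]_(x in `[0%R, +oo[)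
    (expP s0 B * (expR (- s * x)%R)%:E))%E.
  apply: eq_integral => x /set_mem /=; rewrite in_itv/= andbT => x0.
  rewrite [RHS]muleC -exponential_memoryless//; congr (expP s0 _).
  by apply/seteqP; split => v; rewrite /xsection/= inE.
rewrite ge0_integralZl//; last exact: mexp.
by rewrite muleC exponential_prob_laplace.
Qed.

(** * Regeneration of a pair of independent clock sequences *)

Section clock_pair.
Context d (T : measurableType d) (R : realType) (P : probability T R).
Local Notation mR := (measurableTypeR R).
Implicit Types X Y : nat -> T -> mR.

Definition joint_event X Y (A B : nat -> set mR) n : set T :=
  \bigcap_(i in `I_n) (X i @^-1` A i `&` Y i @^-1` B i).

(* Up to the factor [c], under [P] restricted to [E] the two sequences are
   independent of each other and i.i.d. with laws [E1] and [E2]. *)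
Definition clock_pair (E1 E2 : probability mR R) (c : R) (E : set T) X Y :=
  [/\ measurable E,
      (forall i, measurable_fun setT (X i)) /\ (forall i, measurable_fun setT (Y i)),
      (forall w, E w -> forall i, 0 < X i w /\ 0 < Y i w) &
      forall n (A B : nat -> set mR),
        (forall i, measurable (A i)) -> (forall i, measurable (B i)) ->
        P (E `&` joint_event X Y A B n) =
        (c%:E * \prod_(i < n) (E1 (A i) * E2 (B i)))%E].

Lemma clock_pair_sym E1 E2 c E X Y :
  clock_pair E1 E2 c E X Y -> clock_pair E2 E1 c E Y X.
Proof.
move=> [mE [mX mY] E0 EP]; split=> // [w Ew i|n A B mA mB].
  by have [] := E0 _ Ew i.
have -> : joint_event Y X A B n = joint_event X Y B A n.
  by apply: eq_bigcapr => i _; rewrite setIC.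
by rewrite EP//; congr (_ * _)%E; apply: eq_bigr => i _; rewrite muleC.
Qed.

Definition scons (S : Type) (x : S) (u : nat -> S) n :=
  if n is n'.+1 then u n' else x.

Lemma measurable_preimageT (f : T -> mR) (A : set mR) :
  measurable_fun setT f -> measurable A -> measurable (f @^-1` A).
Proof. by move=> mf mA; rewrite -[X in measurable X]setTI; exact: mf. Qed.

Lemma measurable_joint_event X Y A B n :
  (forall i, measurable_fun setT (X i)) -> (forall i, measurable_fun setT (Y i)) ->
  (forall i, measurable (A i)) -> (forall i, measurable (B i)) ->
  measurable (joint_event X Y A B n).
Proof.
move=> mX mY mA mB; apply: fin_bigcap_measurable => [|i _]; first exact: finite_II.
by apply: measurableI; apply: measurable_preimageT.
Qed.

(** Extends the product formula from rectangles to events such as [X 0 < Y 0]: both sides are finite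
    measures in [Z] that agree on rectangles, a generating family stable under intersection. *)
Lemma clock_pair_pairE E1 E2 c E X Y n (A B : nat -> set mR) (Z : set (mR * mR)) :
  clock_pair E1 E2 c E X Y ->
  (forall i, measurable (A i)) -> (forall i, measurable (B i)) -> measurable Z ->
  P (E `&` joint_event (X \o succn) (Y \o succn) A B n `&`
      (fun w => (X 0%N w, Y 0%N w)) @^-1` Z) =
  (c%:E * \prod_(i < n) (E1 (A i) * E2 (B i)) * (E1 \x E2) Z)%E.
Proof.
move=> [mE [mX mY] E0 EP] mA mB mZ.
set D := E `&` _.
have mD : measurable D.
  by apply: measurableI => //; apply: measurable_joint_event => // i; [exact: mX|exact: mY].
have mXY : measurable_fun setT (fun w => (X 0%N w, Y 0%N w)).
  exact: measurable_fun_pair.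
set K := (c%:E * _)%E.
have DE U V : (fun w => (X 0%N w, Y 0%N w)) @^-1` (U `*` V) `&` D =
    E `&` joint_event X Y (scons U A) (scons V B) n.+1.
  rewrite /D setIC -setIA; congr (_ `&` _).
  apply/seteqP; split => w /=.
    by move=> [J [UX VY]] [|i] /= ilt; [split|exact: (J i)].
  by move=> J; split=> [i /= ilt|]; [exact: (J i.+1)|exact: (J 0%N)].
have PDE U V : measurable U -> measurable V ->
    P ((fun w => (X 0%N w, Y 0%N w)) @^-1` (U `*` V) `&` D) = (K * (E1 U * E2 V))%E.
  move=> mU mV; rewrite DE EP; [|by case|by case].
  by rewrite big_ord_recl/= muleCA muleC /K muleA.
(* Taking [U] and [V] full identifies [K] as a probability, hence a finite nonnegative factor by
   which the product measure may be scaled. *)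
have KE : K = P D.
  by have := PDE setT setT; rewrite setXTT preimage_setT setTI !probability_setT !mule1 => ->.
have Kfin : K \is a fin_num by rewrite KE fin_num_measure.
have K0 : 0 <= fine K by rewrite fine_ge0// KE.
pose G : set (set (mR * mR)) :=
  [set C | exists A, measurable A /\ exists B, measurable B /\ C = A `*` B].
pose m1 := measure_function_pushforward__canonical__measure_function_Measure
  (mrestr P mD) mXY.
pose m2 := mscale (NngNum K0) (E1 \x E2)%E.
have m2E C : m2 C = (K * (E1 \x E2) C)%E by rewrite /m2 /mscale/= fineK.
have -> : P (D `&` (fun w => (X 0%N w, Y 0%N w)) @^-1` Z) = m1 Z.
  by rewrite setIC.
rewrite -m2E.
apply: (measure_unique G (fun=> setT)) => //.
- rewrite measurable_prod_measurableType //; congr (<<s _ >>).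
  rewrite predeqE; split => [[U mU [V mV <-]]|[U [mU [V [mV ->]]]]].
    by exists U; split => //; exists V.
  by exists U => //; exists V.
- move=> /= _ _ [X1 [mX1 [X2 [mX2 ->]]]] [Y1 [mY1 [Y2 [mY2 ->]]]].
  rewrite -setXI; exists (X1 `&` Y1); split; first exact: measurableI.
  by exists (X2 `&` Y2); split => //; exact: measurableI.
- by move=> _; exists setT; split=> //; exists setT; split=> //; rewrite setXTT.
- exact: bigcup_const.
- move=> _ [U [mU [V [mV ->]]]].
  apply: etrans (esym (m2E _)); rewrite product_measure1E//; exact: PDE.
- move=> _; rewrite /m1 /= /pushforward /mrestr.
  rewrite (le_lt_trans (probability_le1 _ _)) ?ltry//.
  by apply: measurableI => //; rewrite preimage_setT.
Qed.

(** When [X] wins, its first clock is used up and the first clock of [Y] is replaced by its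
    residual; the race costs the factor [q] and restores the joint law. *)
Lemma clock_pair_race E1 E2 q c E X Y : races E1 E2 q -> clock_pair E1 E2 c E X Y ->
  clock_pair E1 E2 (c * q) (E `&` [set w | X 0%N w < Y 0%N w])
    (X \o succn) (scons (fun w => Y 0%N w - X 0%N w) (Y \o succn)).
Proof.
move=> rE EXY; have [mE [mX mY] E0 EP] := EXY.
have mYX : measurable_fun setT (fun w => Y 0%N w - X 0%N w : mR).
  by apply: measurable_funB; [exact: mY|exact: mX].
have mlt : measurable [set w | X 0%N w < Y 0%N w].
  rewrite (_ : mkset _ = (fun w => Y 0%N w - X 0%N w : mR) @^-1` `]0, +oo[).
    by apply: measurable_preimageT.
  by apply/seteqP; split => w /=; rewrite in_itv/= andbT subr_gt0.
have step n A B : (forall i, measurable (A i)) -> (forall i, measurable (B i)) ->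
  P (E `&` [set w | X 0%N w < Y 0%N w] `&` joint_event (X \o succn)
      (scons (fun w => Y 0%N w - X 0%N w) (Y \o succn)) A B n.+1) =
    ((c * q)%:E * \prod_(i < n.+1) (E1 (A i) * E2 (B i)))%E.
  move=> mA mB.
  (* [B 0] constrains the residual and goes into the race event, so the shifted [Y] has one
     constraint fewer than the shifted [X]; it is padded with [setT]. *)
  pose B' i := if (i < n)%N then B i.+1 else setT.
  have mB' i : measurable (B' i) by rewrite /B'; case: ifP.
  have mZ := measurable_race (mB 0%N).
  have := @clock_pair_pairE E1 E2 c E X Y n.+1 A B' _ EXY mA mB' mZ.
  rewrite rE// => EZ.
  transitivity (c%:E * (\prod_(i < n.+1) (E1 (A i) * E2 (B' i))) *
     (q%:E * E2 (B 0%N)))%E; last first.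
    rewrite !big_split/= [X in (_ * (_ * X) * _)%E]big_ord_recr/=.
    rewrite [X in (_ = _ * (_ * X))%E]big_ord_recl/=.
    rewrite {2}/B' ltnn probability_setT mule1.
    rewrite (eq_bigr (fun i : 'I_n => E2 (B i.+1))); last first.
      by move=> i _; rewrite /B' ltn_ord.
    rewrite EFinM -!muleA; congr (_ * _)%E.
    rewrite [RHS]muleCA; congr (_ * _)%E.
    by rewrite muleCA; congr (_ * _)%E; rewrite muleC.
  rewrite -EZ; congr (P _).
  apply/seteqP; split => w /=.
    move=> [[Ew XY] J]; split; first split => //.
      move=> i /= ilt; split; first by have [] := J i ilt.
      by rewrite /B'; case: ifP => // iltn; have [] := J i.+1 iltn.
    by split=> //; have [] := J 0%N erefl.
  move=> [[Ew J] [XY BXY]]; split=> // -[|i] /= ilt; split=> //.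
  - by have [] := J 0%N erefl.
  - by have [] := J i.+1 ilt.
  - by have [_] := J i (ltnW ilt); rewrite /B' -ltnS ilt.
split=> //.
- exact: measurableI.
- split=> [i|[|i]] /=; [exact: mX|exact: mYX|exact: mY].
- move=> w [Ew /= XY] i; split; first by have [] := E0 _ Ew i.+1.
  by case: i => [|i] /=; [rewrite subr_gt0|have [] := E0 _ Ew i.+1].
(* With no constraint at all the formula is the one-constraint case for full sets. *)
- case=> [A B mA mB|n A B mA mB]; last exact: step.
  have := step 0%N (fun=> setT) (fun=> setT) (fun=> measurableT) (fun=> measurableT).
  rewrite big_ord1 big_ord0 !probability_setT mule1 => <-; congr (P (_ `&` _)).
  by apply/seteqP; split => w.
Qed.
End clock_pair.

(** * Law of the change indicators *)

(** Pathwise boolean form of [change_ind]: [x] holds the gaps between changes, [y] those between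
    accesses. *)
Definition changed (R : realType) (x y : nat -> R) (k : nat) : bool :=
  `[< exists j, \sum_(i < k) y i < \sum_(i < j.+1) x i /\
                \sum_(i < j.+1) x i <= \sum_(i < k.+1) y i >].

(** * The indicators when time restarts at the first event *)

Section changed_race.
Context (R : realType) (x y : nat -> R).
Hypotheses (x_gt0 : forall i, 0 < x i) (y_gt0 : forall i, 0 < y i).

Lemma sum_scons (z : R) k :
  \sum_(i < k.+1) scons z (y \o succn) i = z - y 0%N + \sum_(i < k.+1) y i.
Proof. by rewrite !big_ord_recl/= addrA subrK. Qed.

Lemma changed0_change : x 0%N < y 0%N -> changed x y 0%N.
Proof.
move=> xy; apply/asboolP; exists 0%N; rewrite big_ord0 !big_ord_recl !big_ord0 !addr0.
by split=> //; exact: ltW.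
Qed.

(** Restarting at the first change moves all times by [x 0]. That change lies in interval 0, so
    forgetting it affects no later interval; hence only indices [k.+1] are covered. *)
Lemma changedS_change k : x 0%N < y 0%N ->
  changed x y k.+1 = changed (x \o succn) (scons (y 0%N - x 0%N) (y \o succn)) k.+1.
Proof.
move=> xy; rewrite /changed !sum_scons.
apply/asbool_equiv_eq; split => -[].
- case=> [[+ _]|j H].
    rewrite big_ord_recl big_ord1 => /lt_trans/(_ xy).
    by rewrite -subr_gt0 opprD addNKr oppr_gt0 ltNge sumr_ge0// => i _; exact: ltW.
  by exists j; move: H; rewrite (big_ord_recl j.+1)/= => -[]; lra.
- move=> j H; exists j.+1; rewrite (big_ord_recl j.+1)/=.
  by move: H => /= -[]; lra.
Qed.
End changed_race.

Lemma changed0_access (R : realType) (x y : nat -> R) :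
  (forall i, 0 < x i) -> y 0%N < x 0%N -> changed x y 0%N = false.
Proof.
move=> x0 yx; apply/asboolPn => -[j [_]].
rewrite big_ord1 big_ord_recl => /le_lt_trans/(_ yx).
by rewrite gtrDl ltNge sumr_ge0// => i _; exact: ltW.
Qed.

(** Restarting at the first access moves all times by [y 0] and uses up one interval, so the index
    drops by one. *)
Lemma changedS_access (R : realType) (x y : nat -> R) k :
  changed x y k.+1 = changed (scons (x 0%N - y 0%N) (x \o succn)) (y \o succn) k.
Proof.
rewrite /changed.
apply/asbool_equiv_eq; split => -[j].
- rewrite ![\sum_(i < _.+1) y i]big_ord_recl/= => H; exists j.
  by rewrite sum_scons; move: H => []; lra.
- rewrite sum_scons => H; exists j; rewrite ![\sum_(i < _.+1) y i]big_ord_recl/=.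
  by move: H => []; lra.
Qed.

Section changed_law.
Context d (T : measurableType d) (R : realType) (P : probability T R).
Local Notation mR := (measurableTypeR R).
Implicit Types (X Y : nat -> T -> mR) (b : seq bool).

Definition path_prob (q : R) b := \prod_(x <- b) (if x then q else 1 - q).

Definition history (u : nat -> bool) n := mkseq u n.

Lemma history_cons (u : nat -> bool) n : history u n.+1 = u 0%N :: history (u \o succn) n.
Proof. by rewrite /history /mkseq/= -[1%N]addn0 iotaDl -map_comp. Qed.

Lemma measurable_history (u : nat -> T -> bool) n b :
  (forall k, measurable [set w | u k w]) ->
  measurable [set w | history (u^~ w) n = b].
Proof.
move=> mu; elim: n b => [|n IH] b.
  case: b => [|x b]; first by rewrite (_ : mkset _ = setT)//; apply/seteqP; split=> w.
  by rewrite (_ : mkset _ = set0)//; apply/seteqP; split => w.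
case/lastP: b => [|b x].
  by rewrite (_ : mkset _ = set0)//; apply/seteqP; split => w.
have -> : [set w | history (u^~ w) n.+1 = rcons b x] =
    [set w | history (u^~ w) n = b] `&`
    (if x then [set w | u n w] else ~` [set w | u n w]).
  apply/seteqP; split => w /=; rewrite /history mkseqS.
    move=> /rcons_inj[-> <-]; split=> //.
    by case: ifPn => //= /negP.
  by move=> [-> ux]; congr rcons; case: x ux => //= /negP/negbTE.
apply: measurableI; first exact: IH.
by case: x => //; exact: measurableC.
Qed.

Lemma measurable_changed X Y k :
  (forall i, measurable_fun setT (X i)) -> (forall i, measurable_fun setT (Y i)) ->
  measurable [set w | changed (X^~ w) (Y^~ w) k].
Proof.
move=> mX mY.
have mS (Z : nat -> T -> mR) n : (forall i, measurable_fun setT (Z i)) ->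
    measurable_fun setT (fun w => \sum_(i < n) Z i w : R).
  by move=> mZ; apply: measurable_sum => i; exact: mZ.
rewrite (_ : mkset _ = \bigcup_j (
    [set w | \sum_(i < k) Y i w < \sum_(i < j.+1) X i w] `&`
    ~` [set w | \sum_(i < k.+1) Y i w < \sum_(i < j.+1) X i w])); last first.
  apply/seteqP; split => w /=.
    by move=> /asboolP[j [H1 H2]]; exists j => //; split=> //=; apply/negP; rewrite -leNgt.
  by move=> [j _ [/= H1 /negP]]; rewrite -leNgt => H2; apply/asboolP; exists j.
have mlt n j : measurable [set w | \sum_(i < n) Y i w < \sum_(i < j.+1) X i w].
  rewrite -[X in measurable X]setTI.
  have := @measurable_fun_ltr _ _ _ setT _ _ (mS Y n mY) (mS X j.+1 mX).
  by move=> /(_ measurableT [set true]); apply.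
apply: bigcupT_measurable => j; apply: measurableI => //.
exact: measurableC.
Qed.

(** * Joint law of the indicators from the race property *)

Section history_law.
Variables (E1 E2 : probability mR R) (q : R).
Hypotheses (race12 : races E1 E2 q) (race21 : races E2 E1 (1 - q)).
Hypotheses (q_ge0 : 0 <= q) (q_lt1 : q < 1).

Lemma clock_pair_access c E X Y : clock_pair P E1 E2 c E X Y ->
  clock_pair P E1 E2 (c * (1 - q)) (E `&` [set w | Y 0%N w < X 0%N w])
    (scons (fun w => X 0%N w - Y 0%N w) (X \o succn)) (Y \o succn).
Proof. by move=> /clock_pair_sym/(clock_pair_race race21)/clock_pair_sym. Qed.

(** The shift [s = 1] leaves the current interval out, as is right once a change has been seen in
    it. *)
Definition history_event X Y s b : set T :=
  [set w | history (fun k => changed (X^~ w) (Y^~ w) (k + s)) (size b) = b].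

Lemma measurable_history_event c E X Y s b : clock_pair P E1 E2 c E X Y ->
  measurable (E `&` history_event X Y s b).
Proof.
move=> [mE [mX mY] _ _]; apply: measurableI => //.
by apply: measurable_history => k; exact: measurable_changed.
Qed.

Lemma history_event_cons X Y x b w :
  history_event X Y 0 (x :: b) w <->
  changed (X^~ w) (Y^~ w) 0%N = x /\ history_event X Y 1 b w.
Proof.
rewrite /history_event/= history_cons/=.
have -> : (fun k => changed (X^~ w) (Y^~ w) (k + 0)) \o succn =
    (fun k => changed (X^~ w) (Y^~ w) (k + 1)).
  by apply/funext => k /=; rewrite addn0 addn1.
by split=> [[]|[-> ->]].
Qed.

Lemma history_event_change c E X Y b w : clock_pair P E1 E2 c E X Y -> E w ->
  X 0%N w < Y 0%N w ->
  history_event (X \o succn) (scons (fun w => Y 0%N w - X 0%N w) (Y \o succn)) 1 b w =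
  history_event X Y 1 b w.
Proof.
move=> [_ _ E0 _] Ew XY; rewrite /history_event/=; congr (history _ _ = _).
apply/funext => k; rewrite addn1.
have [X0 Y0] : (forall i, 0 < X i w) /\ (forall i, 0 < Y i w).
  by split=> i; have [] := E0 w Ew i.
rewrite [RHS]changedS_change//.
by congr changed; apply/funext; case.
Qed.

Lemma history_event_access X Y b w :
  history_event (scons (fun w => X 0%N w - Y 0%N w) (X \o succn)) (Y \o succn) 0 b w =
  history_event X Y 1 b w.
Proof.
rewrite /history_event/=; congr (history _ _ = _).
apply/funext => k; rewrite addn1 addn0 [RHS]changedS_access//.
by congr changed; apply/funext; case.
Qed.

(* Ignoring the first indicator, the mass lost by allowing at most [m] further
   changes before the next access is a factor [q ^+ m]. *)
Lemma history_event1_lower_bound b :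
  (forall c E X Y, clock_pair P E1 E2 c E X Y ->
    ((c * path_prob q b)%:E <= P (E `&` history_event X Y 0 b))%E) ->
  forall m c E X Y, clock_pair P E1 E2 c E X Y ->
  ((c * (1 - q ^+ m) * path_prob q b)%:E <= P (E `&` history_event X Y 1 b))%E.
Proof.
move=> IH; elim=> [|m IHm] c E X Y EXY.
  by rewrite expr0 subrr mulr0 mul0r measure_ge0.
have mH := measurable_history_event 1 b EXY.
have EX := clock_pair_race race12 EXY; have EY := clock_pair_access EXY.
have mHX := measurable_history_event 1 b EX.
have mHY := measurable_history_event 0 b EY.
(* Split on the next event. After a change the current interval is still ignored, with [m] changes
   left; after an access the full history [b] starts afresh and [IH] applies. *)
rewrite (_ : c * _ * _ = c * q * (1 - q ^+ m) * path_prob q b +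
  c * (1 - q) * path_prob q b); last by rewrite exprS; ring.
rewrite EFinD (le_trans (leeD (IHm _ _ _ _ EX) (IH _ _ _ _ EY)))//.
rewrite -measureU//.
- apply: le_measure; rewrite ?inE//; first exact: measurableU.
  move=> w [] [[Ew /= XY]]; first by rewrite (history_event_change _ EXY).
  by rewrite history_event_access.
- apply/seteqP; split=> w // -[[[_ /= XY] _] [[_ /= YX] _]].
  by have := lt_trans XY YX; rewrite ltxx.
Qed.

(** A first bit [false] is realised by an access coming first, a first bit [true] by a change coming
    first, after which the current interval no longer matters. *)
Lemma history_lower_bound b c E X Y : clock_pair P E1 E2 c E X Y ->
  ((c * path_prob q b)%:E <= P (E `&` history_event X Y 0 b))%E.
Proof.
elim: b c E X Y => [|x b IH] c E X Y EXY.
  have [mE [mX mY] _ EP] := EXY.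
  have := EP 0%N (fun=> setT) (fun=> setT) (fun=> measurableT) (fun=> measurableT).
  rewrite big_ord0 mule1 /path_prob big_nil mulr1 => <-.
  rewrite /joint_event (_ : `I_0 = set0) ?bigcap_set0; last first.
    by apply/seteqP; split => i.
  by apply: le_measure; rewrite ?inE ?setIT//; exact: measurable_history_event EXY.
have [_ _ E0 _] := EXY.
have mH := measurable_history_event 0 (x :: b) EXY.
rewrite /path_prob big_cons -/(path_prob q b) mulrA.
case: x mH => mH.
  have EX := clock_pair_race race12 EXY.
  have mHX := measurable_history_event 1 b EX.
  apply: (@le_trans _ _ (P (E `&` [set w | X 0%N w < Y 0%N w] `&` history_event (X \o succn)
      (scons (fun w => Y 0%N w - X 0%N w) (Y \o succn)) 1 b))); last first.
    apply: le_measure; rewrite ?inE// => w [[Ew /= XY]].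
    rewrite (history_event_change _ EXY)// => Hw; split=> //.
    apply/history_event_cons; split=> //; apply: changed0_change => //.
    by move=> i; have [] := E0 w Ew i.
  set p := P _; have pfin : p \is a fin_num by rewrite fin_num_measure.
  rewrite -[p]fineK// lee_fin.
  (* The cap [m] on the number of changes is removed in the limit, as [q ^+ m] tends to 0. *)
  have : (fun m => c * q * (1 - q ^+ m) * path_prob q b) @ \oo -->
      c * q * (1 - 0) * path_prob q b.
    apply: cvgMl; apply: cvgMr; apply: cvgB; first exact: cvg_cst.
    by apply: cvg_expr; rewrite ger0_norm.
  rewrite subr0 mulr1 => /cvgr_to_le; apply.
  apply: nearW => m; rewrite -lee_fin fineK//.
  exact: history_event1_lower_bound.
have EY := clock_pair_access EXY.
have mHY := measurable_history_event 0 b EY.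
apply: (le_trans (IH _ _ _ _ EY)).
apply: le_measure; rewrite ?inE// => w [[Ew /= YX]].
rewrite history_event_access => Hw; split=> //.
apply/history_event_cons; split=> //; apply: changed0_access => //.
by move=> i; have [] := E0 w Ew i.
Qed.

(** Induction on the last bit: the two extensions of a history have lower bounds that add up to its
    exact probability, so neither bound can be strict. The empty history is settled by total mass at
    most 1. *)
Lemma history_law b E X Y : clock_pair P E1 E2 1 E X Y ->
  P (E `&` history_event X Y 0 b) = (path_prob q b)%:E.
Proof.
move=> EXY; have mH c := measurable_history_event 0 c EXY.
have pfin c : P (E `&` history_event X Y 0 c) \is a fin_num.
  by rewrite fin_num_measure.
have lb c : path_prob q c <= fine (P (E `&` history_event X Y 0 c)).
  by rewrite -lee_fin fineK// -[path_prob q c]mul1r; exact: history_lower_bound.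
have path_prob_rcons c x :
    path_prob q (rcons c x) = path_prob q c * (if x then q else 1 - q).
  by rewrite /path_prob big_rcons/= mulrC.
have split_last c : fine (P (E `&` history_event X Y 0 c)) =
    fine (P (E `&` history_event X Y 0 (rcons c true))) +
    fine (P (E `&` history_event X Y 0 (rcons c false))).
  rewrite -fineD// -measureU//.
    congr (fine (P _)); rewrite -setIUr; congr (_ `&` _).
    apply/seteqP; split => w; rewrite /history_event/= !size_rcons /history mkseqS.
      by move=> ->; case: (changed _ _ _); [left|right].
    by move=> [] /rcons_inj[].
  apply/seteqP; split=> // w [[_ +] [_]]; rewrite /history_event/= !size_rcons.
  by move=> -> /rcons_inj[].
suff <- : fine (P (E `&` history_event X Y 0 b)) = path_prob q b by rewrite fineK.
elim/last_ind: b => [|b x IH].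
  apply/eqP; rewrite eq_le lb andbT /path_prob big_nil -lee_fin fineK//.
  exact: probability_le1.
have := split_last b; rewrite IH.
have := lb (rcons b true); have := lb (rcons b false).
by rewrite !path_prob_rcons; case: x; lra.
Qed.
End history_law.
End changed_law.

Lemma exponential_history_law d (T : measurableType d) (R : realType)
    (P : probability T R) (Delta p : R) (sigma tau : nat -> {RV P >-> R}) (b : seq bool) :
  0 < Delta -> 0 < p ->
  (forall j, exponentially_distributed P Delta (sigma j)) ->
  (forall k, exponentially_distributed P p (tau k)) ->
  mutually_independent2 P (fun j => sigma j : T -> R) (fun k => tau k : T -> R) ->
  P [set w | history (changed (fun j => sigma j w) (fun k => tau k w)) (size b) = b] =
  (path_prob (Delta / (Delta + p)) b)%:E.
Proof.
move=> D0 p0 sexp texp ind.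
have Dp0 : 0 < Delta + p by exact: addr_gt0.
have race12 := exponential_races D0 p0.
have race21 : races (expP p0) (expP D0) (1 - Delta / (Delta + p)).
  rewrite (_ : 1 - _ = p / (p + Delta)); first exact: exponential_races.
  by field; rewrite addrC gt_eqF.
have q0 : 0 <= Delta / (Delta + p) by rewrite divr_ge0// ltW.
have q1 : Delta / (Delta + p) < 1 by rewrite ltr_pdivrMr// mul1r ltrDl.
pose X j : T -> measurableTypeR R := sigma j.
pose Y k : T -> measurableTypeR R := tau k.
have mX j : measurable_fun setT (X j) by exact: (measurable_funPT (sigma j)).
have mY k : measurable_fun setT (Y k) by exact: (measurable_funPT (tau k)).
(* Outcomes with a nonpositive gap form a null set; its complement is the event on which
   [clock_pair] demands positivity. *)
pose N := \bigcup_i (X i @^-1` `]-oo, 0] `|` Y i @^-1` `]-oo, 0]).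
have mN : measurable N.
  by apply: bigcupT_measurable => i; apply: measurableU; apply: measurable_preimageT.
have PN : P N = 0%E.
  apply/(measure_negligible mN)/negligible_bigcup => i; apply: negligibleU.
  - apply/negligibleP; first exact: measurable_preimageT.
    by rewrite [LHS](sexp i)//; exact: (exponential_prob_le0 D0).
  - apply/negligibleP; first exact: measurable_preimageT.
    by rewrite [LHS](texp i)//; exact: (exponential_prob_le0 p0).
have PI A : measurable A -> P (~` N `&` A) = P A.
  move=> mA; rewrite [~` N `&` A]setIC -setDE (measureDI P mA mN).
  rewrite [X in (_ = _ + X)%E](_ : _ = 0%E) ?adde0//; apply/eqP.
  rewrite -measure_le0 -PN; apply: le_measure; rewrite ?inE//; exact: measurableI.
have EXY : clock_pair P (expP D0) (expP p0) 1 (~` N) X Y.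
  split=> //; first exact: measurableC.
  - move=> w Nw i; rewrite !ltNge; split; apply/negP => le0; apply: Nw; exists i => //=.
      by left; rewrite in_itv.
    by right; rewrite in_itv.
  - move=> n A B mA mB; rewrite PI; last exact: measurable_joint_event.
    rewrite mul1e /joint_event ind; [|by move=> i _; exact (mA i)|by move=> i _; exact (mB i)].
    apply: eq_bigr => i _; congr (_ * _)%E; first exact: (sexp i _ (mA i)).
    exact: (texp i _ (mB i)).
rewrite -(history_law race12 race21 q0 q1 b EXY) PI.
  have addk0 w : (fun k => changed (X^~ w) (Y^~ w) (k + 0)) =
      changed (fun j => sigma j w) (fun k => tau k w).
    by apply/funext => k; rewrite addn0.
  by congr (P _); apply/seteqP; split => w; rewrite /history_event/= addk0.
by apply: measurable_history => k; apply: measurable_changed.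
Qed.

(** * Functionals of a chain driven by i.i.d. bits *)

Section chain.
Context {R : realType}.
Implicit Types (q : R) (G : seq bool -> R) (V : R -> R) (v : nat -> bool)
  (F : nat -> R -> bool -> R).

Fixpoint paths n : seq (seq bool) :=
  if n is n'.+1 then
    [seq rcons b true | b <- paths n'] ++ [seq rcons b false | b <- paths n']
  else [:: [::]].

Lemma size_paths n b : b \in paths n -> size b = n.
Proof.
elim: n b => [|n IH] b; first by rewrite inE => /eqP ->.
by rewrite mem_cat => /orP[] /mapP[c /IH <- ->]; rewrite size_rcons.
Qed.

Lemma history_paths v n : history v n \in paths n.
Proof.
elim: n => // n IH; rewrite /history mkseqS /= mem_cat.
by apply/orP; case: (v n); [left|right]; apply/mapP; exists (mkseq v n).
Qed.

(** Turns a function of a random history into a finite combination of indicators, ready to be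
    integrated. *)
Lemma sum_history (A : pzSemiRingType) n v (G : seq bool -> A) :
  \sum_(b <- paths n) G b * (history v n == b)%:R = G (history v n).
Proof.
elim: n G => [|n IH] G; first by rewrite big_seq1 eqxx mulr1.
rewrite /= big_cat !big_map/= -big_split/= {3}/history mkseqS.
rewrite -[RHS](IH (fun b => G (rcons b (v n)))); apply: eq_bigr => b _.
by rewrite /history mkseqS !eqseq_rcons; case: (v n);
  rewrite ?(andbT, andbF) ?(mulr0, addr0, add0r).
Qed.

(** Expectation over [n] independent Bernoulli([q]) bits, kept as a finite sum so that moments need
    no integrability argument. *)
Definition path_mean q n G := \sum_(b <- paths n) path_prob q b * G b.

Lemma path_meanS q n G : path_mean q n.+1 G =
  path_mean q n (fun b => q * G (rcons b true) + (1 - q) * G (rcons b false)).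
Proof.
rewrite /path_mean /= big_cat !big_map/= -big_split/=; apply: eq_bigr => b _.
by rewrite /path_prob !big_rcons/=; ring.
Qed.

Lemma path_mean_affine q n G a c :
  path_mean q n (fun b => a * G b + c) = a * path_mean q n G + c.
Proof.
elim: n G => [|n IH] G.
  by rewrite /path_mean !big_seq1 /path_prob big_nil !mul1r.
rewrite !path_meanS -IH; congr path_mean; apply/funext => b; ring.
Qed.

Lemma le_path_mean q n G G' : 0 <= q <= 1 ->
  (forall b, size b = n -> G b <= G' b) -> path_mean q n G <= path_mean q n G'.
Proof.
move=> /andP[q0 q1] GG'; rewrite /path_mean big_seq [leRHS]big_seq.
apply: ler_sum => b /size_paths/GG' GG'b; apply: ler_wpM2l => //.
by apply: prodr_ge0 => x _; case: x => //; rewrite subr_ge0.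
Qed.

Fixpoint chain F (x0 : R) v n :=
  if n is n'.+1 then F n' (chain F x0 v n') (v n') else x0.

Lemma eq_chain F x0 v v' n : (forall k, (k < n)%N -> v k = v' k) ->
  chain F x0 v n = chain F x0 v' n.
Proof.
elim: n => // n IH vv' /=; rewrite vv'// IH// => k kn.
by apply: vv'; exact: ltnW.
Qed.

Lemma chain_history F x0 v n :
  chain F x0 v n = chain F x0 (nth false (history v n)) n.
Proof. by apply: eq_chain => k kn; rewrite nth_mkseq. Qed.

Definition chain_mean q F x0 n V :=
  path_mean q n (fun b => V (chain F x0 (nth false b) n)).

Lemma le_chain_mean q F x0 n V V' : 0 <= q <= 1 -> (forall x, V x <= V' x) ->
  chain_mean q F x0 n V <= chain_mean q F x0 n V'.
Proof. by move=> q01 VV'; apply: le_path_mean => // b _. Qed.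

Lemma chain_mean_affine q F x0 n V a c :
  chain_mean q F x0 n (fun x => a * V x + c) = a * chain_mean q F x0 n V + c.
Proof. exact: path_mean_affine. Qed.

(** Given the first [n] bits, the last one is still Bernoulli([q]), so a pointwise bound on the
    one-step average passes to the means. It serves both the mean-square recursion and the stopped
    sums. *)
Lemma chain_mean_drift q F x0 n V a c : 0 <= q <= 1 ->
  (forall x, q * V (F n x true) + (1 - q) * V (F n x false) <= a * V x + c) ->
  chain_mean q F x0 n.+1 V <= a * chain_mean q F x0 n V + c.
Proof.
move=> q01 drift; rewrite -chain_mean_affine /chain_mean path_meanS.
apply: le_path_mean => // b bn.
have E x : chain F x0 (nth false (rcons b x)) n.+1 = F n (chain F x0 (nth false b) n) x.
  rewrite /= nth_rcons bn ltnn eqxx; congr F; apply: eq_chain => k kn.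
  by rewrite nth_rcons bn kn.
by rewrite !E.
Qed.
End chain.

Section chain_integral.
Context d (T : measurableType d) (R : realType) (P : probability T R).
Variables (q : R) (u : nat -> T -> bool).
Hypothesis mu : forall k, measurable [set w | u k w].
Hypothesis law : forall b,
  P [set w | history (u^~ w) (size b) = b] = (path_prob q b)%:E.

Lemma integral_history n (G : seq bool -> R) : (forall b, 0 <= G b) ->
  (\int[P]_w (G (history (u^~ w) n))%:E = (path_mean q n G)%:E)%E.
Proof.
move=> G0; pose A b : set T := [set w | history (u^~ w) n = b].
have mA b : measurable (A b) by exact: measurable_history.
have m1A b : measurable_fun setT (\1_(A b) : T -> R) by exact: measurable_indic.
transitivity (\int[P]_w (\sum_(b <- paths n) ((G b)%:E * (\1_(A b) w)%:E)))%E.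
  apply: eq_integral => w _; rewrite -(sum_history n (u^~ w) G) -sumEFin.
  apply: eq_bigr => b _; rewrite -EFinM indicE; congr (_ * (nat_of_bool _)%:R)%:E.
  by apply/eqP/idP; [exact: mem_set|exact: set_mem].
rewrite ge0_integral_sum//.
- rewrite -sumEFin big_seq [RHS]big_seq; apply: eq_bigr => b /size_paths bn.
  rewrite ge0_integralZl//; last 2 first.
  - exact/measurable_EFinP.
  - by rewrite lee_fin.
  rewrite integral_indic// setIT EFinM muleC; congr (_ * _)%E.
  by rewrite -law bn.
- by move=> b; apply: emeasurable_funM => //; exact/measurable_EFinP.
- by move=> b w _; rewrite mule_ge0// lee_fin.
Qed.

Lemma measurable_history_pred n (Q : seq bool -> bool) :
  measurable [set w | Q (history (u^~ w) n)].
Proof.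
rewrite (_ : mkset _ = \bigcup_(b in [set` [seq b <- paths n | Q b]])
   [set w | history (u^~ w) n = b]).
  apply: fin_bigcup_measurable; first exact: finite_seq.
  by move=> b _; exact: measurable_history.
apply/seteqP; split => w /=.
  move=> Qw; exists (history (u^~ w) n) => //=.
  by rewrite mem_filter Qw history_paths.
by move=> [b /=]; rewrite mem_filter => /andP[Qb _] ->.
Qed.

Lemma integral_chain F x0 n (V : R -> R) : (forall x, 0 <= V x) ->
  (\int[P]_w (V (chain F x0 (u^~ w) n))%:E = (chain_mean q F x0 n V)%:E)%E.
Proof.
move=> V0; rewrite -integral_history//; apply: eq_integral => w _.
by rewrite chain_history.
Qed.
End chain_integral.

(** * Mean square rate *)

Definition sa_step (R : realType) (eta : nat -> R) (p : R) k (y : R) (i : bool) : R :=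
  y + eta k * (i%:R * (y + p) - y).

Lemma sa_estimator_chain T (R : realType) (sigma tau : nat -> T -> R) eta p y0 k w :
  sa_estimator sigma tau eta p y0 k w =
  chain (sa_step eta p) y0 (changed (fun j => sigma j w) (fun i => tau i w)) k.
Proof. by elim: k => //= k ->. Qed.

(* [q p = (1 - q) Delta], i.e. [Delta] is the zero of the mean field. *)
Lemma sa_step_drift (R : realType) (eta : nat -> R) (Delta p q : R) k (y : R) :
  0 < Delta -> 0 < p -> q = Delta / (Delta + p) ->
  q * (sa_step eta p k y true - Delta) ^+ 2 +
    (1 - q) * (sa_step eta p k y false - Delta) ^+ 2 <=
  (1 - 2 * (1 - q) * eta k + (1 + Delta + p) ^+ 2 * eta k ^+ 2) * (y - Delta) ^+ 2 +
    (1 + Delta + p) ^+ 2 * eta k ^+ 2.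
Proof.
move=> D0 p0 qE.
have Dp0 : 0 < Delta + p by exact: addr_gt0.
have qpE : q * p = (1 - q) * Delta by rewrite qE; field; rewrite gt_eqF.
have q0 : 0 <= q by rewrite qE divr_ge0// ltW.
have q1 : 0 <= 1 - q by rewrite subr_ge0 qE ler_pdivrMr// mul1r lerDl ltW.
rewrite /sa_step /= mul1r mul0r sub0r; set z := y - Delta.
rewrite (_ : y + _ - _ = z + eta k * p); last by rewrite /z; ring.
rewrite (_ : y + eta k * - y - Delta = z - eta k * (z + Delta)); last by rewrite /z; ring.
have -> : q * (z + eta k * p) ^+ 2 + (1 - q) * (z - eta k * (z + Delta)) ^+ 2 =
    (1 - 2 * (1 - q) * eta k) * z ^+ 2 + 2 * eta k * z * (q * p - (1 - q) * Delta) +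
    eta k ^+ 2 * (q * p ^+ 2 + (1 - q) * (z + Delta) ^+ 2) by ring.
(* The cross term vanishes because the mean field is zero at [Delta]. [C] is chosen to dominate
   [p ^+ 2 + (1 + Delta) ^+ 2], the coefficients bounding the two squares that remain. *)
rewrite qpE subrr mulr0 addr0; set C := (1 + Delta + p) ^+ 2.
have -> : (1 - 2 * (1 - q) * eta k + C * eta k ^+ 2) * z ^+ 2 + C * eta k ^+ 2 =
    (1 - 2 * (1 - q) * eta k) * z ^+ 2 + eta k ^+ 2 * (C * (z ^+ 2 + 1)) by ring.
rewrite lerD2l.
apply: ler_wpM2l; first exact: sqr_ge0.
have z2 : 0 <= z ^+ 2 by exact: sqr_ge0.
have zD : (z + Delta) ^+ 2 <= (1 + Delta) ^+ 2 * (z ^+ 2 + 1).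
  have := sqr_ge0 (z * Delta - 1); rewrite -subr_ge0 => H.
  have : 0 <= 2 * Delta * (z ^+ 2 + 1) by rewrite !mulr_ge0 ?addr_ge0// ltW.
  by move: H; nra.
have h1 : q * p ^+ 2 <= p ^+ 2 * (z ^+ 2 + 1).
  have := mulr_ge0 (sqr_ge0 p) z2; have := mulr_ge0 q1 (sqr_ge0 p); nra.
have h2 : (1 - q) * (z + Delta) ^+ 2 <= (1 + Delta) ^+ 2 * (z ^+ 2 + 1).
  apply: le_trans zD; rewrite ler_piMl ?sqr_ge0//; lra.
apply: (le_trans (lerD h1 h2)).
rewrite -mulrDl; apply: ler_wpM2r; first by rewrite addr_ge0.
rewrite /C; nra.
Qed.

Lemma powR_unbounded (R : realType) (a M : R) : 0 < a ->
  exists N : nat, forall k : nat, (N <= k)%N -> M <= k.+1%:R `^ a.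
Proof.
move=> a0; pose x := (Num.max M 1) `^ a^-1.
exists (Num.truncn x) => k Nk.
apply: (@le_trans _ _ (Num.max M 1)); first by rewrite le_max lexx.
have -> : Num.max M 1 = x `^ a.
  by rewrite /x -powRrM mulVf ?gt_eqF// powRr1// le_max ler01 orbT.
apply: ge0_ler_powR; rewrite ?nnegrE ?powR_ge0 ?(ltW a0)//.
by apply/ltW/(lt_le_trans (truncnS_gt _)); rewrite ler_nat ltnS.
Qed.

(** * Solving the mean-square recursion for polynomial step sizes *)

Section rate.
Context (R : realType) (e s C : R) (m eta : nat -> R).
Hypotheses (e01 : 0 < e < 1) (s_gt0 : 0 < s) (C_ge0 : 0 <= C).
Hypothesis (etaE : forall k, eta k = (k.+1%:R `^ e)^-1).
Hypothesis (m_rec : forall k,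
  m k.+1 <= (1 - 2 * s * eta k + C * eta k ^+ 2) * m k + C * eta k ^+ 2).

(** With [t = 1 + 1/(k+1)], the ratio of consecutive steps is [t] to the power [- e], which is at
    least [1 / t] since [e < 1], and so at least [1 - 1/(k+1)]. *)
Lemma step_size_ratio k : eta k * (1 - k.+1%:R^-1) <= eta k.+1.
Proof.
have [e0 e1] := andP e01.
have k0 : 0 < k.+1%:R :> R by rewrite ltr0n.
pose t : R := 1 + k.+1%:R^-1.
have t0 : 0 < t by rewrite addr_gt0 ?invr_gt0.
have tE : k.+2%:R = k.+1%:R * t by rewrite /t mulrDr mulr1 divff ?gt_eqF// natr1.
rewrite !etaE tE powRM ?(ltW k0) ?(ltW t0)// invfM; apply: ler_wpM2l.
  by rewrite invr_ge0 powR_ge0.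
have t1 : 1 <= t by rewrite lerDl invr_ge0 ltW.
have te : t `^ e <= t by rewrite -[leRHS]powRr1 ?(ltW t0)// ler_powR// ltW.
apply: (@le_trans _ _ t^-1); last by rewrite lef_pV2 ?posrE ?powR_gt0.
rewrite -[leRHS]mul1r ler_pdivlMr// /t.
set x := k.+1%:R^-1; have := sqr_ge0 x; nra.
Qed.

(** Induction on [m k <= K * x] with [x = eta k]. The contraction gains [2 * s * K * x ^+ 2]: half
    of it pays for the noise [C * x ^+ 2], a quarter for the cubic term, and a quarter for the decay
    of [eta] from [k] to [k.+1]. *)
Lemma step_size_recursion_rate : (forall k, 0 <= m k) ->
  exists K : R, exists N : nat, forall k, (N <= k)%N -> m k <= K * eta k.
Proof.
move=> m0; have [e0 e1] := andP e01.
have eta0 k : 0 < eta k by rewrite etaE invr_gt0 powR_gt0// ltr0n.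
(* Beyond [N1], [2 * s * eta k <= 1] and [C * eta k <= s / 2]; beyond [N2],
   [1/(k+1) <= s / 2 * eta k], which is where [e < 1] enters. *)
have [N1 H1] := powR_unbounded (2 * s + 2 * C / s + 1) e0.
have [N2 H2] : exists N : nat, forall k : nat, (N <= k)%N ->
    2 / s <= k.+1%:R `^ (1 - e).
  by apply: powR_unbounded; rewrite subr_gt0.
pose N := maxn N1 N2; pose K := Num.max (C / s) (m N / eta N).
have KC : C <= K * s.
  by rewrite -ler_pdivrMr// le_max lexx.
have K0 : 0 <= K by rewrite le_max divr_ge0// ltW.
exists K, N; elim=> [|k IH].
  by rewrite leqn0 => /eqP N0; rewrite -N0 -ler_pdivrMr// le_max lexx orbT.
rewrite leq_eqVlt => /predU1P[<-|Nk].
  by rewrite -ler_pdivrMr// le_max lexx orbT.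
have {}IH := IH Nk.
have k1 : 0 < k.+1%:R :> R by rewrite ltr0n.
have A1 := H1 k (leq_trans (leq_maxl _ _) Nk).
have A2 := H2 k (leq_trans (leq_maxr _ _) Nk).
have ek : eta k * k.+1%:R `^ e = 1 by rewrite etaE mulVf// gt_eqF// powR_gt0.
have Cs0 : 0 <= 2 * C / s by rewrite divr_ge0 ?mulr_ge0// ltW.
have B1 : 2 * s * eta k <= 1.
  rewrite -[leRHS]ek [leLHS]mulrC ler_pM2l// (le_trans _ A1)//.
  by move: Cs0; set r := 2 * C / s; lra.
have B2 : C * eta k <= s / 2.
  have Cse : 2 * C / s * eta k <= 1.
    rewrite -[leRHS]ek [leLHS]mulrC ler_pM2l// (le_trans _ A1)//.
    by have := s_gt0; set r := 2 * C / s; lra.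
  rewrite (_ : C * eta k = 2 * C / s * eta k * (s / 2)).
    by apply: ler_piMl => //; rewrite divr_ge0// ltW.
  by field; rewrite gt_eqF.
have B3 : k.+1%:R^-1 <= s / 2 * eta k.
  rewrite -(@powRr1 _ k.+1%:R) ?(ltW k1)// -[X in _ `^ X](subrKC e 1) powRD; last first.
    by rewrite (gt_eqF k1) implybT.
  rewrite invfM -etaE mulrC; apply: ler_wpM2r; first exact: ltW.
  by rewrite -[s / 2]invrK lef_pV2 ?posrE ?invf_div// ?divr_gt0// powR_gt0.
apply: (le_trans (m_rec k)).
apply: (@le_trans _ _ (K * (eta k * (1 - k.+1%:R^-1)))); last first.
  by apply: ler_wpM2l => //; exact: step_size_ratio.
set x := eta k in IH B1 B2 B3 *.
have x0 : 0 < x by exact: eta0.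
have a0 : 0 <= 1 - 2 * s * x + C * x ^+ 2.
  by rewrite addr_ge0 ?subr_ge0// mulr_ge0// sqr_ge0.
apply: (@le_trans _ _ ((1 - 2 * s * x + C * x ^+ 2) * (K * x) + C * x ^+ 2)).
  by rewrite lerD2r ler_wpM2l.
have C1 : K * x * (C * x ^+ 2) <= K * x * (s / 2 * x).
  by rewrite ler_wpM2l ?mulr_ge0 ?(ltW x0)// expr2 mulrA ler_wpM2r// ltW.
have C2 : K * x * k.+1%:R^-1 <= K * x * (s / 2 * x).
  by rewrite ler_wpM2l ?mulr_ge0 ?(ltW x0).
have C3 : C * x ^+ 2 <= K * s * x ^+ 2 by rewrite ler_wpM2r ?sqr_ge0.
move: C1 C2 C3; set i := k.+1%:R^-1; nra.
Qed.
End rate.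

(** * Almost sure convergence *)

(** Once [eps] is below [e / 2], a step turns an excess of at most [x N / (1 + A n)] over [e / 2]
    into one of at most [x N / (1 + A n.+1)], since [(1 - b) * (1 + c + b) <= 1 + c] for
    [b, c >= 0]; and [A n] diverges. *)
Lemma contraction_cvg0 (R : realType) (N0 : nat) (a eps x : nat -> R) :
  (forall k, 0 <= a k) -> (forall k, (N0 <= k)%N -> a k <= 1) -> (forall k, 0 <= x k) ->
  (forall k, (N0 <= k)%N -> x k.+1 <= (1 - a k) * x k + a k * eps k) ->
  series a @ \oo --> +oo -> eps @ \oo --> 0 -> x @ \oo --> 0.
Proof.
move=> a0 a1 x0 xrec aoo eps0; apply/cvgr0Pnorm_le => e e0.
have e20 : 0 < e / 2 by rewrite divr_gt0.
have [N1 _ H1] : \forall k \near \oo, eps k <= e / 2.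
  move/cvgr0Pnorm_le : eps0 => /(_ _ e20); apply: filterS => k.
  exact/le_trans/ler_norm.
pose N := maxn N0 N1; pose A n := \sum_(i < n) a (N + i)%N.
have A0 n : 0 <= A n by exact: sumr_ge0.
have bound n : x (N + n)%N <= e / 2 + x N / (1 + A n).
  elim: n => [|n IH].
    by rewrite addn0 /A big_ord0 addr0 divr1 lerDr ltW.
  have N0n : (N0 <= N + n)%N by rewrite (leq_trans (leq_maxl _ N1))// leq_addr.
  have N1n : (N1 <= N + n)%N by rewrite (leq_trans (leq_maxr N0 _))// leq_addr.
  rewrite addnS; apply: (le_trans (xrec _ N0n)).
  have An : A n.+1 = A n + a (N + n)%N by rewrite /A big_ord_recr.
  have := a0 (N + n)%N; have := a1 _ N0n; have := H1 _ N1n; have := x0 N.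
  have := A0 n; rewrite An.
  move: IH; set b := a (N + n)%N; set c := A n; set X := x N; set E := eps _.
  move=> IH c0 X0 Ee b1 b0.
  have d1 : 0 < 1 + c by rewrite ltr_pwDl.
  have d2 : 0 < 1 + (c + b) by rewrite ltr_pwDl// addr_ge0.
  apply: (@le_trans _ _ ((1 - b) * (e / 2 + X / (1 + c)) + b * (e / 2))).
    by apply: lerD; apply: ler_wpM2l => //; rewrite subr_ge0.
  rewrite (_ : _ + b * _ = e / 2 + X * ((1 - b) / (1 + c))); last by ring.
  rewrite lerD2l; apply: ler_wpM2l => //.
  rewrite ler_pdivrMr// mulrC ler_pdivlMr//; nra.
have AE n : A n = series a (N + n)%N - series a N.
  elim: n => [|n IH]; first by rewrite addn0 subrr /A big_ord0.
  rewrite /A big_ord_recr/= -/(A n) IH addnS [series a (N + n).+1]seriesSr; ring.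
have [N2 _ H2] : \forall n \near \oo, 2 * x N / e + series a N <= series a n.
  exact: (cvgry_ge aoo).
exists (N + N2)%N => // k /= Nk; rewrite ger0_norm//.
have Nk' : (N <= k)%N by rewrite (leq_trans _ Nk)// leq_addr.
have := bound (k - N)%N; rewrite AE subnKC// => /le_trans; apply.
have /H2 : (N2 <= k)%N by rewrite (leq_trans _ Nk)// leq_addl.
rewrite -lerBrDr => H.
have d0 : 0 < 1 + (series a k - series a N).
  rewrite ltr_pwDl// (le_trans _ H)//; apply: divr_ge0; last exact: ltW.
  by rewrite mulr_ge0.
rewrite [leRHS]splitr lerD2l ler_pdivrMr//.
rewrite -ler_pdivrMl// invf_div mulrC mulrA [_ * 2]mulrC (le_trans H)// lerDr.
exact: ler01.
Qed.

Lemma sa_step_cvg (R : realType) (eta : nat -> R) (Delta p q y0 : R) (v : nat -> bool) :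
  0 < Delta -> 0 < p -> q = Delta / (Delta + p) -> (forall k, 0 < eta k) ->
  series eta @ \oo --> +oo -> eta @ \oo --> 0 ->
  cvg (series (fun k => eta k * ((v k)%:R - q)) @ \oo) ->
  chain (sa_step eta p) y0 v @ \oo --> Delta.
Proof.
move=> D0 p0 qE eta0 etaoo eta_to0 /cvg_ex[L SL].
have Dp0 : 0 < Delta + p by exact: addr_gt0.
have q1 : 0 < 1 - q by rewrite subr_gt0 qE ltr_pdivrMr// mul1r ltrDl.
have qDp : q * (Delta + p) = Delta by rewrite qE divfK// gt_eqF.
set S := series _ in SL.
pose y := chain (sa_step eta p) y0 v.
pose a k := eta k * (1 - (v k)%:R).
have v01 k : 0 <= 1 - (v k)%:R :> R /\ 1 - (v k)%:R <= 1 :> R.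
  by case: (v k); rewrite ?subrr ?subr0 ?lexx ?ler01.
have a0 k : 0 <= a k by rewrite mulr_ge0 ?(ltW (eta0 k))//; case: (v01 k).
have aeta k : a k <= eta k by rewrite ler_piMr ?(ltW (eta0 k))//; case: (v01 k).
have [N0 _ HN0] : \forall k \near \oo, eta k <= 1.
  move/cvgr0Pnorm_le : eta_to0 => /(_ _ ltr01); apply: filterS => k.
  exact/le_trans/ler_norm.
have aoo : series a @ \oo --> +oo.
  (* [S] converges and hence stays bounded above, so the divergence of [series eta] carries over. *)
  rewrite (_ : series a = (fun n => (1 - q) * series eta n - S n)).
    apply/cvgryPge => A.
    have S_le : \forall n \near \oo, S n <= L + 1.
      by apply: (cvgr_le _ SL); rewrite ltrDl.
    have eta_ge : \forall n \near \oo, (A + (L + 1)) / (1 - q) <= series eta n.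
      exact: (cvgry_ge etaoo).
    apply: filterS2 S_le eta_ge => n S_le; rewrite ler_pdivrMr// => eta_ge; lra.
  apply/funext; elim=> [|n IH]; first by rewrite /S !seriesEnat/= !big_geq// mulr0 subrr.
  by rewrite /S !seriesSr IH /a /S; ring.
(* With the noise tail subtracted, the remaining perturbation carries the factor [a k], the form
   required by [contraction_cvg0]. *)
pose x k := `|y k - Delta - (Delta + p) * (S k - L)|.
pose eps k := (Delta + p) * `|S k - L|.
have SL0 : (fun k => S k - L) @ \oo --> 0.
  by rewrite -(subrr L); apply: cvgB => //; exact: cvg_cst.
have x_to0 : x @ \oo --> 0.
  apply: (@contraction_cvg0 _ N0 a eps) => //.
  - by move=> k Nk; exact: le_trans (aeta k) (HN0 k Nk).
  - by move=> k; exact: normr_ge0.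
  - move=> k Nk; rewrite /x.
    have a1 : 0 <= 1 - a k by rewrite subr_ge0 (le_trans (aeta k))// HN0.
    rewrite (_ : y k.+1 - Delta - _ = (1 - a k) * (y k - Delta - (Delta + p) * (S k - L)) -
       a k * ((Delta + p) * (S k - L))).
      rewrite (le_trans (ler_normB _ _))// (normrM (1 - a k)) (normrM (a k)).
      rewrite (normrM (Delta + p)) (ger0_norm a1) (ger0_norm (a0 k)).
      by rewrite (gtr0_norm Dp0).
    rewrite /y /= -/y [S k.+1]seriesSr /sa_step /a -/S.
    apply/subr0_eq; rewrite [LHS](_ : _ = eta k * (q * (Delta + p) - Delta)); last by ring.
    by rewrite qDp subrr mulr0.
  - rewrite /eps -(mulr0 (Delta + p)); apply: cvgMr.
    by rewrite -(@normr0 _ R); exact: cvg_norm.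
rewrite -/y.
have -> : y = (fun k =>
    Delta + ((y k - Delta - (Delta + p) * (S k - L)) + (Delta + p) * (S k - L))).
  by apply/funext => k; ring.
rewrite -[X in _ --> X]addr0; apply: cvgD; first exact: cvg_cst.
rewrite -[X in _ --> X]addr0; apply: cvgD; first exact/norm_cvg0P.
by rewrite -(mulr0 (Delta + p)); apply: cvgMr.
Qed.

(* The partial sums from time [m] on, frozen once they reach level [lam] in
   absolute value: bounding their second moment replaces a maximal inequality. *)
Definition stopped_step (R : realType) (eta : nat -> R) (q lam : R) (m k : nat)
    (x : R) (i : bool) : R :=
  if lam <= `|x| then x else x + (m <= k)%:R * eta k * (i%:R - q).

(** An unfrozen increment has mean zero and variance at most [eta k ^+ 2]; a frozen one adds
    nothing. The factor [1] fits [chain_mean_drift]. *)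
Lemma stopped_step_drift (R : realType) (eta : nat -> R) (q lam : R) m k (x : R) :
  0 <= q <= 1 ->
  q * stopped_step eta q lam m k x true ^+ 2 +
    (1 - q) * stopped_step eta q lam m k x false ^+ 2 <=
  1 * x ^+ 2 + (m <= k)%:R * eta k ^+ 2.
Proof.
move=> /andP[q0 q1]; rewrite /stopped_step mul1r.
have e2 : 0 <= (m <= k)%:R * eta k ^+ 2 by rewrite mulr_ge0 ?sqr_ge0.
case: ifPn => _; first by rewrite -mulrDl subrKC mul1r lerDl.
set c : R := (m <= k)%:R in e2 *.
have cc : c ^+ 2 = c by rewrite /c; case: (m <= k)%N; rewrite ?expr1n ?expr0n.
rewrite [leLHS](_ : _ = x ^+ 2 + c ^+ 2 * eta k ^+ 2 * (q * (1 - q))) /=; last by ring.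
rewrite cc lerD2l ler_piMr//; nra.
Qed.

(** * Almost sure convergence of the centred weighted series *)

Section random_series.
Context d (T : measurableType d) (R : realType) (P : probability T R).
Variables (q : R) (u : nat -> T -> bool) (eta : nat -> R).
Hypothesis mu : forall k, measurable [set w | u k w].
Hypothesis law : forall b,
  P [set w | history (u^~ w) (size b) = b] = (path_prob q b)%:E.
Hypothesis q01 : 0 <= q <= 1.
Hypothesis eta2_cvg : cvg (series (fun k => eta k ^+ 2) @ \oo).

Local Notation s2 := (series (fun k => eta k ^+ 2)).
Local Notation stopped lam m n w := (chain (stopped_step eta q lam m) 0 (u^~ w) n).

Lemma nondecreasing_series_sqr : nondecreasing_seq s2.
Proof. by apply: nondecreasing_series => k _ _; exact: sqr_ge0. Qed.

Lemma stopped_second_moment lam m n :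
  chain_mean q (stopped_step eta q lam m) 0 n (fun x => x ^+ 2) <= limn s2 - s2 m.
Proof.
(* Steps before [m] add nothing, hence [maxn m n] in place of [n]. *)
apply: (@le_trans _ _ (s2 (maxn m n) - s2 m)); last first.
  by rewrite lerD2r; apply: nondecreasing_cvgn_le => //; exact: nondecreasing_series_sqr.
elim: n => [|n IH].
  rewrite maxn0 subrr /chain_mean /path_mean big_seq1 /=.
  by rewrite expr0n mulr0.
have := @chain_mean_drift R q (stopped_step eta q lam m) 0 n (fun x => x ^+ 2) 1 _ q01
  (fun x => stopped_step_drift eta lam m n x q01).
move=> /le_trans; apply.
rewrite mul1r; apply: (le_trans (lerD IH (lexx _))).
rewrite addrAC lerD2r; case: (leqP m n) => mn.
  by rewrite mul1r (maxn_idPr (leqW mn)) seriesSr.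
by rewrite mul0r addr0 (maxn_idPl mn).
Qed.

Lemma measurable_stopped_ge lam m n : measurable [set w | lam <= `|stopped lam m n w|].
Proof.
rewrite (_ : mkset _ = [set w | lam <=
    `|chain (stopped_step eta q lam m) 0 (nth false (history (u^~ w) n)) n|]).
  exact: (@measurable_history_pred _ _ _ mu n
    (fun b => lam <= `|chain (stopped_step eta q lam m) 0 (nth false b) n|)).
by apply/funext => w; rewrite /mkset -chain_history.
Qed.

Lemma stopped_chebyshev (lam : R) m n : 0 < lam ->
  (P [set w | lam <= `|stopped lam m n w|]%R <= (lam ^- 2 * (limn s2 - s2 m))%:E)%E.
Proof.
move=> lam0; pose V (x : R) : R := (lam <= `|x|)%R%:R.
have -> : P [set w | lam <= `|stopped lam m n w|] =
    (chain_mean q (stopped_step eta q lam m) 0 n V)%:E.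
  rewrite -(integral_chain mu law); last by move=> x; rewrite /V.
  rewrite -[X in P X]setIT -integral_indic//; last exact: measurable_stopped_ge.
  apply: eq_integral => w _; rewrite indicE /V; congr EFin; congr GRing.natmul.
  by congr nat_of_bool; apply/idP/idP; rewrite inE.
rewrite lee_fin.
apply: (@le_trans _ _
  (lam ^- 2 * chain_mean q (stopped_step eta q lam m) 0 n (fun x => x ^+ 2))).
  rewrite -[leRHS]addr0 -chain_mean_affine; apply: le_chain_mean => // x.
  rewrite /V addr0 mulrC ler_pdivlMr ?exprn_gt0//; case: (leP lam `|x|) => lx.
    by rewrite /= mul1r -[x ^+ 2]real_normK ?num_real// ler_sqr ?nnegrE ?normr_ge0 ?(ltW lam0).
  by rewrite /= mul0r sqr_ge0.
apply: ler_wpM2l; last exact: stopped_second_moment.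
by rewrite invr_ge0 exprn_ge0// ltW.
Qed.

Lemma stoppedS_ge lam m n w : lam <= `|stopped lam m n w| -> lam <= `|stopped lam m n.+1 w|.
Proof. by move=> h; rewrite /= {1}/stopped_step h. Qed.

(** Freezing makes the events increase with [n], so the uniform Chebyshev bound passes to their
    union by continuity from below. *)
Lemma stopped_maximal (lam : R) m : 0 < lam ->
  (P (\bigcup_n [set w | lam <= `|stopped lam m n w|]%R) <=
   (lam ^- 2 * (limn s2 - s2 m))%:E)%E.
Proof.
move=> lam0.
have mB n := measurable_stopped_ge lam m n.
have ndB : nondecreasing_seq (fun n => [set w | lam <= `|stopped lam m n w|]).
  by apply/nondecreasing_seqP => n; apply/subsetPset => w /=; exact: stoppedS_ge.
have cvgB := nondecreasing_cvg_mu (mu := P) mB (bigcupT_measurable _ mB) ndB.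
rewrite -(cvg_lim _ cvgB)//; apply: lime_le; first by apply/cvg_ex; eexists; exact: cvgB.
by apply: nearW => n; exact: stopped_chebyshev.
Qed.

(** A path that never reaches [lam] is never frozen. *)
Lemma stoppedE lam m w : (forall n, `|stopped lam m n w| < lam) ->
  forall n, stopped lam m n w = series (fun k => eta k * ((u k w)%:R - q)) (maxn m n) -
    series (fun k => eta k * ((u k w)%:R - q)) m.
Proof.
move=> small; elim=> [|n IH]; first by rewrite maxn0 subrr.
rewrite /= {1}/stopped_step ifN -?ltNge// IH.
case: (leqP m n) => mn.
  by rewrite mul1r (maxn_idPr (leqW mn)) seriesSr; ring.
by rewrite !mul0r addr0 (maxn_idPl mn).
Qed.

Lemma random_series_cvg :
  {ae P, forall w, cvg (series (fun k => eta k * ((u k w)%:R - q)) @ \oo)}.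
Proof.
pose B l m := \bigcup_n [set w | l.+1%:R^-1 <= `|stopped l.+1%:R^-1 m n w|].
have mB l m : measurable (B l m).
  by apply: bigcupT_measurable => n; exact: measurable_stopped_ge.
(* Outcomes for which, at some level, the sums restarted at every [m] reach that level. For fixed
   [l] the mass is at most the tail bound for every [m], hence zero; off [N] the partial sums are
   Cauchy. *)
pose N := \bigcup_l \bigcap_m B l m.
have mN l : measurable (\bigcap_m B l m) by exact: bigcapT_measurable.
exists N; split.
- exact: bigcupT_measurable.
- apply: measure_negligible; first exact: bigcupT_measurable.
  apply: negligible_bigcup => l; apply/negligibleP => //.
  have l0 : 0 < l.+1%:R^-1 :> R by rewrite invr_gt0.
  apply/eqP; rewrite -measure_le0.
  have tail0 : (fun m => ((l.+1%:R^-1) ^- 2 * (limn s2 - s2 m))%:E) @ \oo --> (0 : R)%:E.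
    apply: cvg_EFin; first exact: nearW.
    rewrite -[X in _ --> X](mulr0 ((l.+1%:R^-1) ^- 2)); apply: cvgMr.
    by rewrite -(subrr (limn s2)); apply: cvgB => //; exact: cvg_cst.
  rewrite (_ : 0%E = limn (fun m => ((l.+1%:R^-1) ^- 2 * (limn s2 - s2 m))%:E)); last first.
    by rewrite (cvg_lim _ tail0).
  apply: lime_ge; first by apply/cvg_ex; eexists; exact: tail0.
  apply: nearW => m; apply: le_trans (stopped_maximal m l0).
  by apply: le_measure; rewrite ?inE; [exact: mN|exact: mB|move=> w; exact].
- move=> w /= ncvg; apply: contrapT => Nw; apply: ncvg.
  apply/cauchy_cvgP/cauchy_exP => e e0.
  have [l le] : exists l : nat, l.+1%:R^-1 < e.
    exists (Num.truncn e^-1); rewrite invf_plt ?posrE//; exact: truncnS_gt.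
  have [m small] : exists m, forall n, `|stopped l.+1%:R^-1 m n w| < l.+1%:R^-1.
    apply: contrapT => nsmall; apply: Nw; exists l => // m _.
    apply: contrapT => nB; apply: nsmall; exists m => n; rewrite ltNge.
    by apply/negP => ge; apply: nB; exists n.
  exists (series (fun k => eta k * ((u k w)%:R - q)) m), m => // n /= mn.
  rewrite -ball_normE /= distrC (lt_trans _ le)//.
  by have := small n; rewrite (stoppedE small) (maxn_idPr mn).
Qed.
End random_series.

(** * Transfer of both convergence results to the estimator *)

Theorem theorem2 (d : measure_display) (T : measurableType d) (R : realType)
    (P : probability T R) (Delta p : R) (sigma tau : nat -> {RV P >-> R})
    (eta : nat -> R) (y0 : R) :
  0 < Delta -> 0 < p ->
  (forall j, exponentially_distributed P Delta (sigma j)) ->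
  (forall k, exponentially_distributed P p (tau k)) ->
  mutually_independent2 P (fun j => sigma j : T -> R) (fun k => tau k : T -> R) ->
  (forall k, 0 < eta k) ->
  ((series eta @ \oo --> +oo) ->
   cvg (series (fun k => eta k ^+ 2) @ \oo) ->
   {ae P, forall w,
     (fun k => sa_estimator (fun j => sigma j : T -> R) (fun k => tau k : T -> R)
                 eta p y0 k w) @ \oo --> Delta}) /\
  (forall e : R, 0 < e < 1 ->
   (forall k, eta k = ((k.+1)%:R `^ e)^-1) ->
   exists C : R, exists K : nat, forall k : nat, (K <= k)%N ->
     (\int[P]_w `|sa_estimator (fun j => sigma j : T -> R) (fun k => tau k : T -> R)
                   eta p y0 k w - Delta|%:E <= (C * k%:R `^ (- (e / 2)))%:E)%E).
Proof.
move=> D0 p0 sexp texp ind eta0.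
pose q : R := Delta / (Delta + p).
have Dp0 : 0 < Delta + p by exact: addr_gt0.
have q_gt0 : 0 < q by exact: divr_gt0.
have q_lt1 : q < 1 by rewrite ltr_pdivrMr// mul1r ltrDl.
have q01 : 0 <= q <= 1 by rewrite !ltW.
pose u k w := changed (fun j => sigma j w) (fun i => tau i w) k.
have mu k : measurable [set w | u k w].
  apply: (@measurable_changed _ _ _ sigma tau) => i.
    exact: (measurable_funPT (sigma i)).
  exact: (measurable_funPT (tau i)).
have law b : P [set w | history (u^~ w) (size b) = b] = (path_prob q b)%:E.
  exact: exponential_history_law.
split=> [etaoo eta2|e e01 etaE].
  have eta2_to0 := cvg_series_cvg_0 eta2.
  have eta_to0 : eta @ \oo --> 0.
    apply/cvgr0Pnorm_le => x x0.
    have x2 : 0 < x ^+ 2 by rewrite exprn_gt0.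
    move/cvgr0Pnorm_le : eta2_to0 => /(_ _ x2); apply: filterS => k.
    rewrite ger0_norm ?sqr_ge0// ler_sqr ?nnegrE ?(ltW x0) ?(ltW (eta0 k))//.
    by rewrite ger0_norm// ltW.
  have := random_series_cvg mu law q01 eta2; apply: filterS => w Sw.
  under eq_fun do rewrite sa_estimator_chain.
  exact: (sa_step_cvg y0 D0 p0 erefl eta0 etaoo eta_to0 Sw).
pose C := (1 + Delta + p) ^+ 2; pose F := sa_step eta p.
pose V (y : R) := (y - Delta) ^+ 2.
have C0 : 0 <= C by exact: sqr_ge0.
have s0 : 0 < 1 - q by rewrite subr_gt0.
have m_rec k : chain_mean q F y0 k.+1 V <=
    (1 - 2 * (1 - q) * eta k + C * eta k ^+ 2) * chain_mean q F y0 k V + C * eta k ^+ 2.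
  by apply: chain_mean_drift => // y; exact: sa_step_drift.
have m_ge0 k : 0 <= chain_mean q F y0 k V.
  have <- : chain_mean q F y0 k (fun x => 0 * V x + 0) = 0.
    by rewrite chain_mean_affine mul0r addr0.
  by apply: le_chain_mean => // x; rewrite mul0r addr0 sqr_ge0.
have [K [N mK]] := step_size_recursion_rate e01 s0 C0 etaE m_rec m_ge0.
(* With [t = k%:R] to the power [- (e / 2)], the second moment is at most [K * t ^+ 2], and AM-GM in
   the form [|z| <= z ^+ 2 / (2 * t) + t / 2] yields [(K + 1) / 2]. Starting at 1 ensures
   [t > 0]. *)
exists ((K + 1) / 2), (maxn N 1) => k; rewrite geq_max => /andP[Nk k_gt0].
have k0 : 0 < k%:R :> R by rewrite ltr0n.
set t := k%:R `^ (- (e / 2)).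
have t0 : 0 < t by rewrite powR_gt0.
have K0 : 0 <= K.
  by have := le_trans (m_ge0 _) (mK _ (leqnn N)); rewrite pmulr_lge0.
(* [eta k] is a power of [k.+1], the target rate one of [k]; the shift goes in the favourable
   direction. *)
have eta_t : eta k <= t ^+ 2.
  have e0 : 0 < e by case/andP: e01.
  rewrite etaE /t -powR_mulrn ?powR_ge0// -powRrM mulNr divfK// powRN.
  rewrite lef_pV2 ?posrE ?powR_gt0//.
  by apply: ge0_ler_powR; rewrite ?nnegrE ?(ltW e0)// ler_nat.
pose W (y : R) := `|y - Delta|.
rewrite [leLHS](_ : _ = (chain_mean q F y0 k W)%:E); last first.
  rewrite -(integral_chain mu law); last by move=> x; exact: normr_ge0.
  by apply: eq_integral => w _; rewrite sa_estimator_chain.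
rewrite lee_fin.
apply: (@le_trans _ _ ((2 * t)^-1 * chain_mean q F y0 k V + t / 2)).
  rewrite -chain_mean_affine; apply: le_chain_mean => // y.
  have -> : (2 * t)^-1 * V y + t / 2 = (V y + t ^+ 2) / (2 * t).
    by field; rewrite gt_eqF.
  rewrite ler_pdivlMr ?mulr_gt0//.
  have := sqr_ge0 (W y - t); rewrite sqrrB real_normK ?num_real// -/(V y); lra.
have mt : chain_mean q F y0 k V <= K * t ^+ 2.
  by apply: (le_trans (mK _ Nk)); apply: ler_wpM2l.
have -> : (K + 1) / 2 * t = (2 * t)^-1 * (K * t ^+ 2) + t / 2.
  by field; rewrite gt_eqF.
by rewrite lerD2r; apply: ler_wpM2l => //; rewrite invr_ge0 mulr_ge0// ltW.
Qed.
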